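(* Let $(X,e)$ be a pointed metric space with metric $d$. Then the topology induced by the matching distance $d_{\mathbb{N}[X]}$ makes $\mathbb{N}[X]$, with addition given by concatenation of multisets $[x_1,\dots,x_m]+[y_1,\dots,y_n]=[x_1,\dots,x_m,y_1,\dots,y_n]$ and identity element $[e]$, an abelian topological monoid.
   Context: Let $(X,d)$ be a metric space with distinguished basepoint $e\in X$. For $n\ge 1$, $\mathrm{SP}^n(X)=X^n/S_n$ is the quotient of $X^n$ by the coordinate-permutation action of the symmetric group $S_n$; the orbit of $(x_1,\dots,x_n)$ is written $[x_1,\dots,x_n]$. The map $[x_1,\dots,x_n]\mapsto[x_1,\dots,x_n,e]$ embeds $\mathrm{SP}^n(X)$ in $\mathrm{SP}^{n+1}(X)$, and the set $\mathrm{SP}(X)$ is the union $\bigcup_{n\ge1}\mathrm{SP}^n(X)$ of the increasing sequence so obtained. Thus elements of $\mathrm{SP}(X)$ are finite unordered lists $[x_1,\dots,x_m]$ of points of $X$, with $[x_1,\dots,x_m]=[x_1,\dots,x_m,e]$. Matching distance: for $[x_1,\dots,x_m],[y_1,\dots,y_n]\in \mathrm{SP}(X)$ and $N\ge m+n$ let $\mathbf{x}_N=(x_1,\dots,x_m,e,\dots,e)$ and $\mathbf{y}_N=(y_1,\dots,y_n,e,\dots,e)$ be the lists padded with copies of $e$ to length $N$, and let $\mathbf{x}_N(i)$, $\mathbf{y}_N(i)$ be their $i$-th entries. Then $$d_{\mathbb{N}[X]}([x_1,\dots,x_m],[y_1,\dots,y_n]):=\inf_{N\ge m+n}\ \min_{\sigma\in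 S_N}\ \sum_{i=1}^N d\bigl(\mathbf{x}_N(i),\mathbf{y}_N(\sigma(i))\bigr),$$ which is a well-defined metric on the set $\mathrm{SP}(X)$. The metric space $(\mathrm{SP}(X),d_{\mathbb{N}[X]})$ is denoted $\mathbb{N}[X]$. An abelian topological monoid is a commutative monoid with a topology for which the addition map is (jointly) continuous. *)

(* Defs.v *)
From HB Require Import structures.
From mathcomp Require Import all_boot all_order all_algebra all_fingroup.
From mathcomp Require Import generic_quotient.
From mathcomp Require Import all_classical all_reals all_analysis.

Set Implicit Arguments.
Unset Strict Implicit.
Unset Printing Implicit Defensive.

Import Order.TTheory GRing.Theory Num.Theory.
Local Open Scope ring_scope.
Local Open Scope classical_set_scope.
Local Open Scope quotient_scope.

Section SymmetricProduct.
Variables (X : choiceType) (e : X).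
Implicit Types s t : seq X.

Definition pad (N : nat) s : seq X := s ++ nseq (N - size s) e.

(* Equality in the union of the SP^n(X): lists of lengths m and n define the
   same element when their images in SP^(max m n)(X) are the same orbit.  The
   empty list is allowed as a representative; it is identified with [:: e], so
   the quotient is the same as for nonempty lists. *)
Definition sp_equiv s t : bool :=
  let N := maxn (size s) (size t) in perm_eq (pad N s) (pad N t).

Lemma size_pad N s : (size s <= N)%N -> size (pad N s) = N.
Proof. by move=> sN; rewrite size_cat size_nseq subnKC. Qed.

Lemma nth_pad N s i : nth e (pad N s) i = nth e s i.
Proof.
rewrite nth_cat nth_nseq if_same.
by case: ltnP => // /(nth_default e) ->.
Qed.

Lemma pad_widen N M s : (size s <= N)%N -> (N <= M)%N ->
  pad M s = pad N s ++ nseq (M - N) e.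
Proof.
move=> sN NM; rewrite /pad -catA -nseqD; congr (_ ++ nseq _ _).
by rewrite addnC addnBA // subnK.
Qed.

Lemma sp_equivP N s t : (size s <= N)%N -> (size t <= N)%N ->
  sp_equiv s t = perm_eq (pad N s) (pad N t).
Proof.
move=> sN tN; rewrite /sp_equiv; set M := maxn _ _.
have MN : (M <= N)%N by rewrite geq_max sN.
by rewrite (pad_widen _ MN) ?leq_maxl// (pad_widen _ MN) ?leq_maxr// perm_cat2r.
Qed.

Lemma sp_equiv_refl : reflexive sp_equiv.
Proof. by move=> s; rewrite /sp_equiv perm_refl. Qed.

Lemma sp_equiv_sym : symmetric sp_equiv.
Proof. by move=> s t; rewrite /sp_equiv maxnC perm_sym. Qed.

Lemma sp_equiv_trans : transitive sp_equiv.
Proof.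
move=> t s u; set N := (size s + size t + size u)%N.
have sN : (size s <= N)%N by rewrite /N -addnA leq_addr.
have tN : (size t <= N)%N by rewrite /N addnAC leq_addl.
have uN : (size u <= N)%N by rewrite /N leq_addl.
by rewrite !(@sp_equivP N)//; exact: perm_trans.
Qed.

Canonical sp_equiv_equiv :=
  EquivRel sp_equiv sp_equiv_refl sp_equiv_sym sp_equiv_trans.

Definition SP := {eq_quot sp_equiv}.

Lemma sp_equiv_permP N s t : (size s <= N)%N -> (size t <= N)%N ->
  reflect (exists p : 'S_N, forall i : 'I_N, nth e s i = nth e t (p i))
          (sp_equiv s t).
Proof.
move=> sN tN; rewrite (@sp_equivP N)//.
have Ht : size (pad N t) == N by rewrite size_pad.
rewrite -[pad N t]/(tval (Tuple Ht)).
apply: (iffP tuple_permP) => -[p hp]; exists p.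
  move=> i; rewrite -(nth_pad N s) hp (nth_map i) ?size_enum_ord//.
  by rewrite (tnth_nth e) /= nth_ord_enum nth_pad.
apply: (@eq_from_nth _ e); first by rewrite size_pad// size_tuple.
move=> i; rewrite size_pad// => iN.
rewrite nth_pad (hp (Ordinal iN)) (nth_map (Ordinal iN)) ?size_enum_ord//.
by rewrite (tnth_nth e) /= (nth_ord_enum _ (Ordinal iN)) nth_pad.
Qed.

End SymmetricProduct.

Section MatchingDistance.
Variables (R : realType) (X : metricType R) (e : X).
Implicit Types s t u : seq X.

Definition matching_cost (N : nat) s t (sigma : 'S_N) : R :=
  \sum_(i < N) mdist (nth e (pad e N s) i) (nth e (pad e N t) (sigma i)).

(* The default value of the iterated minimum is itself one of the costs. *)
Definition min_matching_cost (N : nat) s t : R :=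
  \big[Num.min/matching_cost s t (1%g : 'S_N)]_(sigma : 'S_N) matching_cost s t sigma.

Definition matching_dist s t : R :=
  inf [set min_matching_cost N s t | N in [set N | (size s + size t <= N)%N]].

Lemma matching_cost_ge0 N s t (p : 'S_N) : 0 <= matching_cost s t p.
Proof. by apply: sumr_ge0 => i _; exact: mdist_ge0. Qed.

Lemma min_matching_cost_le N s t (p : 'S_N) :
  min_matching_cost N s t <= matching_cost s t p.
Proof. exact: bigmin_le. Qed.

Lemma min_matching_cost_ex N s t :
  exists p : 'S_N, min_matching_cost N s t = matching_cost s t p.
Proof.
rewrite /min_matching_cost.
elim/big_ind: _ => [|x y [p ->] [q ->]|p _]; [by exists 1%g| |by exists p].
by case: (leP (matching_cost s t p)); [exists p|exists q].
Qed.

Lemma matching_cost_widen N M s t (p : 'S_N) :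
  (size s <= N)%N -> (size t <= N)%N -> (N <= M)%N ->
  exists q : 'S_M, matching_cost s t q = matching_cost s t p.
Proof.
move=> sN tN /subnK <-; elim: (M - N)%N => [|k [q <-]]; first by exists p.
exists (lift_perm ord_max ord_max q).
rewrite /matching_cost big_ord_recr /= lift_perm_id !nth_pad.
rewrite !nth_default ?(leq_trans sN) ?(leq_trans tN) ?leq_addl//.
rewrite mdistxx addr0; apply: eq_bigr => i _; rewrite !nth_pad.
have -> : widen_ord (leqnSn (k + N)) i = lift ord_max i.
  by apply: val_inj; rewrite /= /bump leqNgt ltn_ord.
by rewrite lift_perm_lift lift_max.
Qed.

Lemma matching_dist_has_inf s t : has_inf
  [set min_matching_cost N s t | N in [set N | (size s + size t <= N)%N]].
Proof.
split; first by eexists; exists (size s + size t)%N => /=.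
exists 0 => _ [N _ <-].
by have [p ->] := min_matching_cost_ex N s t; exact: matching_cost_ge0.
Qed.

Lemma matching_dist_le N s t (p : 'S_N) :
  (size s <= N)%N -> (size t <= N)%N -> matching_dist s t <= matching_cost s t p.
Proof.
move=> sN tN.
have [q <-] := matching_cost_widen p sN tN (leq_addr (size s + size t) N).
apply: le_trans (min_matching_cost_le s t q).
apply: ge_inf; first by have [] := matching_dist_has_inf s t.
by exists (N + (size s + size t))%N; rewrite //= leq_addl.
Qed.

Lemma matching_dist_lt K s t c : matching_dist s t < c ->
  exists N, [/\ (K <= N)%N, (size s + size t <= N)%N &
    exists p : 'S_N, matching_cost s t p < c].
Proof.
move=> /(inf_lt (matching_dist_has_inf s t).1) [_ [N /= stN <-]].
have [p ->] := min_matching_cost_ex N s t => pc.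
exists (maxn K N); split; rewrite ?leq_maxl ?(leq_trans stN) ?leq_maxr//.
have [||q q_eq] := @matching_cost_widen N (maxn K N) s t p _ _ (leq_maxr _ _).
- exact: leq_trans (leq_addr _ _) stN.
- exact: leq_trans (leq_addl _ _) stN.
by exists q; rewrite q_eq.
Qed.

Lemma matching_dist_sym s t : matching_dist s t = matching_dist t s.
Proof.
wlog suff le : s t / matching_dist s t <= matching_dist t s.
  by apply/eqP; rewrite eq_le !le.
rewrite leNgt; apply/negP => /(matching_dist_lt 0)[N [_ tsN [p]]].
apply/negP; rewrite -leNgt.
have -> : matching_cost t s p = matching_cost s t (p^-1)%g.
  rewrite /matching_cost (reindex_inj (@perm_inj _ (p^-1)%g)) /=.
  by apply: eq_bigr => i _; rewrite permKV metric_sym.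
apply: matching_dist_le.
- exact: leq_trans (leq_addl _ _) tsN.
- exact: leq_trans (leq_addr _ _) tsN.
Qed.

Lemma matching_dist_triangle t s u :
  matching_dist s u <= matching_dist s t + matching_dist t u.
Proof.
apply/ler_addgt0Pr => eps eps0.
have lt_eps2 (x : R) : x < x + eps / 2 by rewrite ltrDl divr_gt0.
have [N [_ stN [p pc]]] :=
  @matching_dist_lt 0 s t (matching_dist s t + eps / 2) (lt_eps2 _).
have [M [NM tuM [q qc]]] :=
  @matching_dist_lt N t u (matching_dist t u + eps / 2) (lt_eps2 _).
have sN := leq_trans (leq_addr (size t) (size s)) stN.
have tN := leq_trans (leq_addl (size s) (size t)) stN.
have uM := leq_trans (leq_addl (size t) (size u)) tuM.
have [p' p'_eq] := matching_cost_widen p sN tN NM.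
apply: (@le_trans _ _ (matching_cost s t p' + matching_cost t u q)); last first.
  by rewrite p'_eq [X in _ <= _ + X]splitr [leRHS]addrACA lerD// ltW.
apply: le_trans (matching_dist_le (p' * q)%g (leq_trans sN NM) uM) _.
rewrite /matching_cost [X in _ <= _ + X](reindex_inj (@perm_inj _ p')) /=.
rewrite -big_split ler_sum// => i _.
by rewrite permM metric_triangle.
Qed.

Lemma matching_dist_equiv s t : sp_equiv e s t -> matching_dist s t = 0.
Proof.
have sN : (size s <= size s + size t)%N by rewrite leq_addr.
have tN : (size t <= size s + size t)%N by rewrite leq_addl.
move=> /(sp_equiv_permP e sN tN) [p hp].
apply/eqP; rewrite eq_le; apply/andP; split.
  apply: le_trans (matching_dist_le p sN tN) _.
  by rewrite /matching_cost big1// => i _; rewrite !nth_pad hp mdistxx.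
apply: lb_le_inf; first by have [] := matching_dist_has_inf s t.
move=> _ [N _ <-].
by have [q ->] := min_matching_cost_ex N s t; exact: matching_cost_ge0.
Qed.

Lemma matching_dist_eq0 s t : matching_dist s t = 0 -> sp_equiv e s t.
Proof.
move=> st0.
have sep (r : seq (X * X)) : exists2 c : R, 0 < c &
    forall z, z \in r -> mdist z.1 z.2 < c -> z.1 = z.2.
  elim: r => [|z r [c c0 hc]]; first by exists 1.
  have [zz|zz] := eqVneq z.1 z.2.
    by exists c => // y; rewrite inE => /predU1P[->//|/hc].
  exists (Num.min c (mdist z.1 z.2)); first by rewrite lt_min c0 mdist_gt0.
  move=> y; rewrite inE lt_min => /predU1P[->|yr] /andP[yc yz].
    by rewrite ltxx in yz.
  exact: hc.
have [c c0 hc] := sep [seq (x, y) | x <- e :: s, y <- e :: t].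
have [N [_ stN [p pc]]] : exists N, [/\ (0 <= N)%N, (size s + size t <= N)%N &
    exists p : 'S_N, matching_cost s t p < c].
  by apply: matching_dist_lt; rewrite st0.
have sN := leq_trans (leq_addr (size t) (size s)) stN.
have tN := leq_trans (leq_addl (size s) (size t)) stN.
have nth_in (r : seq X) i : nth e r i \in e :: r.
  have [ir|ri] := ltnP i (size r); first by rewrite inE mem_nth ?orbT.
  by rewrite nth_default// mem_head.
apply/(sp_equiv_permP e sN tN); exists p => i.
apply: (hc (nth e s i, nth e t (p i))); first exact: allpairs_f.
apply: le_lt_trans pc; rewrite /matching_cost (bigD1 i) //= !nth_pad lerDl.
by apply: sumr_ge0 => j _; exact: mdist_ge0.
Qed.

Definition NX := SP e.

HB.instance Definition _ := Choice.on NX.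

Definition NX_class s : NX := \pi_(SP e) s.

Definition NX_dist (a b : NX) : R := matching_dist (repr a) (repr b).

Definition NX_add (a b : NX) : NX := NX_class (repr a ++ repr b).

Lemma NX_class_eq s t : NX_class s = NX_class t <-> sp_equiv e s t.
Proof.
rewrite /NX_class /SP; split=> [/eqP|st]; first by rewrite eqquotE.
by apply/eqP; rewrite eqquotE.
Qed.

Lemma NX_distE s t : NX_dist (NX_class s) (NX_class t) = matching_dist s t.
Proof.
have dist_congr s1 s2 t1 : sp_equiv e s1 s2 ->
    matching_dist s1 t1 <= matching_dist s2 t1.
  move=> /matching_dist_equiv s12.
  by rewrite (le_trans (matching_dist_triangle s2 _ _))// s12 add0r.
have {}dist_congr s1 s2 t1 : sp_equiv e s1 s2 ->
    matching_dist s1 t1 = matching_dist s2 t1.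
  move=> s12; apply/eqP; rewrite eq_le !dist_congr//.
  by rewrite sp_equiv_sym.
have reprE s1 : sp_equiv e (repr (NX_class s1)) s1.
  by apply/NX_class_eq; exact: reprK.
rewrite /NX_dist (dist_congr _ _ _ (reprE s)) matching_dist_sym.
by rewrite (dist_congr _ _ _ (reprE t)) matching_dist_sym.
Qed.

Lemma NX_distxx a : NX_dist a a = 0.
Proof. exact/matching_dist_equiv/sp_equiv_refl. Qed.

Lemma NX_dist_positivity a b : NX_dist a b = 0 -> a = b.
Proof.
move=> /matching_dist_eq0 /NX_class_eq.
by rewrite /NX_class !reprK.
Qed.

Lemma NX_dist_sym a b : NX_dist a b = NX_dist b a.
Proof. exact: matching_dist_sym. Qed.

Lemma NX_dist_triangle b a c : NX_dist a c <= NX_dist a b + NX_dist b c.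
Proof. exact: matching_dist_triangle. Qed.

HB.instance Definition _ := isMetric.Build R NX
  NX_distxx NX_dist_positivity NX_dist_sym NX_dist_triangle.

Lemma mdist_NX_class s t :
  mdist (NX_class s : NX) (NX_class t : NX) = matching_dist s t.
Proof. exact: NX_distE. Qed.

End MatchingDistance.

(* Unbundled form of topologicalNmodType, for an addition that is not assumed
   to be a monoid law beforehand. *)
Record abelian_topological_monoid (T : topologicalType)
    (add : T -> T -> T) (zero : T) : Prop := {
  atm_assoc : associative add;
  atm_comm : commutative add;
  atm_left_id : left_id zero add;
  atm_continuous : continuous (fun z : T * T => add z.1 z.2) }.

(* Main.v *)
Require Import Defs.
From HB Require Import structures.
From mathcomp Require Import all_boot all_order all_algebra all_fingroup.
From mathcomp Require Import generic_quotient.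
From mathcomp Require Import all_classical all_reals all_analysis.

(** Addition is concatenation of representatives, so the monoid laws are the
    laws of concatenation up to permutation and copies of [e], once
    [NX_add_class] shows that the chosen representatives are irrelevant.

    Continuity is a consequence of the subadditivity
    [d(a + b, a' + b') <= d(a, a') + d(b, b')] of the matching distance
    ([mdist_NX_add_le]), which makes addition Lipschitz.  The reason for
    subadditivity is that two matchings, one between [a] and [a'] and one
    between [b] and [b'], can be placed side by side.  Permutations of padded
    lists are awkward to juxtapose, since the padding of the first pair of
    lists comes before the entries of the second.  So a matching is encoded
    instead as a list [r] of matched pairs: its two projections represent the
    two elements that are matched, its cost is the sum of the distances within
    the pairs, and juxtaposition is concatenation.
    [matching_dist_lt_coupling] and [matching_dist_unzip_le] together say that
    the matching distance is the infimum of the costs of such lists. *)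

Set Implicit Arguments.
Unset Strict Implicit.
Unset Printing Implicit Defensive.
Import Order.TTheory GRing.Theory Num.Theory.
Local Open Scope ring_scope.

(** Unlike the definition, which pads both lists to their common length, this
    form leaves the two amounts of padding free, so that equivalences can be
    concatenated without computing any lengths. *)
Lemma sp_equiv_nseqP (X : choiceType) (e : X) (s t : seq X) :
  sp_equiv e s t <-> exists m n, perm_eq (s ++ nseq m e) (t ++ nseq n e).
Proof.
split=> [st|[m [n st]]]; first by do 2!eexists; exact: st.
have /perm_size := st; rewrite !size_cat !size_nseq => mn.
rewrite (@sp_equivP _ _ (size s + m)%N) ?leq_addr//; last first.
  by rewrite mn leq_addr.
by rewrite /pad {2}mn !addKn.
Qed.

Lemma sp_equiv_cat (X : choiceType) (e : X) (s s' t t' : seq X) :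
  sp_equiv e s s' -> sp_equiv e t t' -> sp_equiv e (s ++ t) (s' ++ t').
Proof.
move=> /sp_equiv_nseqP [m [n ss]] /sp_equiv_nseqP [k [l tt]].
apply/sp_equiv_nseqP; exists (m + k)%N, (n + l)%N.
rewrite !nseqD perm_catACA perm_sym perm_catACA perm_sym.
exact: perm_cat.
Qed.

Section Couplings.
Variables (R : realType) (X : metricType R) (e : X).
Implicit Types (s t : seq X) (r : seq (X * X)).

(** A list of pairs is already a matching, by the identity permutation, of its
    two projections. *)
Lemma matching_dist_unzip_le r :
  matching_dist e (unzip1 r) (unzip2 r) <= \sum_(z <- r) mdist z.1 z.2.
Proof.
apply: le_trans
  (@matching_dist_le _ _ e (size r) (unzip1 r) (unzip2 r) 1%g _ _) _;
  rewrite ?size_map// /matching_cost (big_nth (e, e)) big_mkord.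
apply: ler_sum => i _.
by rewrite perm1 !nth_pad !(nth_map (e, e)).
Qed.

(** The pairs matched by a nearly optimal permutation, padding included, form
    the list; the projections are then only equivalent to the given lists,
    which is all that matters in the quotient. *)
Lemma matching_dist_lt_coupling s t (c : R) : matching_dist e s t < c ->
  exists r, [/\ sp_equiv e s (unzip1 r), sp_equiv e t (unzip2 r) &
    \sum_(z <- r) mdist z.1 z.2 < c].
Proof.
move=> /(matching_dist_lt 0)[N [_ stN [p pc]]].
have sN := leq_trans (leq_addr (size t) (size s)) stN.
have tN := leq_trans (leq_addl (size s) (size t)) stN.
exists [seq (nth e s i, nth e t (p i)) | i : 'I_N <- enum 'I_N].
have nthE (f : 'I_N -> X) (i : 'I_N) : nth e [seq f j | j <- enum 'I_N] i = f i.
  by rewrite (nth_map i) ?size_enum_ord// nth_ord_enum.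
split.
- rewrite /unzip1 -map_comp.
  apply/(@sp_equiv_permP _ e N) => //; first by rewrite size_map size_enum_ord.
  by exists 1%g => i; rewrite perm1 nthE.
- rewrite /unzip2 -map_comp.
  apply/(@sp_equiv_permP _ e N) => //; first by rewrite size_map size_enum_ord.
  by exists (p^-1)%g => i; rewrite nthE /= permKV.
- rewrite big_map big_enum /=; apply: le_lt_trans pc.
  by apply: ler_sum => i _; rewrite !nth_pad.
Qed.

Lemma NX_class_repr (a : NX e) : NX_class e (repr a) = a.
Proof. exact: reprK. Qed.

Lemma NX_add_class s t :
  NX_add (NX_class e s) (NX_class e t) = NX_class e (s ++ t).
Proof.
by apply/NX_class_eq/sp_equiv_cat; apply/NX_class_eq; exact: NX_class_repr.
Qed.

(** Nearly optimal lists of pairs for the two summands concatenate to a list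
    of pairs for the sums, whose cost is the sum of the two costs. *)
Lemma mdist_NX_add_le (a b a' b' : NX e) :
  mdist (NX_add a b) (NX_add a' b') <= mdist a a' + mdist b b'.
Proof.
rewrite -[a]NX_class_repr -[b]NX_class_repr -[a']NX_class_repr.
rewrite -[b']NX_class_repr !NX_add_class.
move: (repr a) (repr b) (repr a') (repr b') => s t s' t'.
apply/ler_addgt0Pr => eps eps0.
rewrite !mdist_NX_class.
have lt_eps2 (x : R) : x < x + eps / 2 by rewrite ltrDl divr_gt0.
have [r [sr s'r rc]] :=
  matching_dist_lt_coupling (lt_eps2 (matching_dist e s s')).
have [q [tq t'q qc]] :=
  matching_dist_lt_coupling (lt_eps2 (matching_dist e t t')).
rewrite -mdist_NX_class.
have -> : NX_class e (s ++ t) = NX_class e (unzip1 (r ++ q)).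
  by apply/NX_class_eq; rewrite /unzip1 map_cat; exact: sp_equiv_cat.
have -> : NX_class e (s' ++ t') = NX_class e (unzip2 (r ++ q)).
  by apply/NX_class_eq; rewrite /unzip2 map_cat; exact: sp_equiv_cat.
rewrite mdist_NX_class (le_trans (matching_dist_unzip_le _))// big_cat /=.
by rewrite [eps in leRHS]splitr addrACA lerD// ltW.
Qed.

End Couplings.

Theorem theorem3p4 (R : realType) (X : metricType R) (e : X) :
  (forall s t : seq X,
     NX_add (NX_class e s) (NX_class e t) = NX_class e (s ++ t)) /\
  abelian_topological_monoid (@NX_add R X e) (NX_class e [:: e]).
Proof.
split; first exact: NX_add_class.
split.
- move=> a b c.
  rewrite -(NX_class_repr a) -(NX_class_repr b) -(NX_class_repr c).
  by rewrite !NX_add_class catA.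
- move=> a b; rewrite -(NX_class_repr a) -(NX_class_repr b) !NX_add_class.
  apply/NX_class_eq/sp_equiv_nseqP; exists 0%N, 0%N.
  by rewrite !cats0 perm_catC.
- move=> a; rewrite -(NX_class_repr a) NX_add_class.
  apply/NX_class_eq/sp_equiv_nseqP; exists 0%N, 1%N.
  by rewrite cats0 perm_catC.
- move=> [a b].
  apply/cvg_ballP => eps eps0.
  exists (ball a (eps / 2), ball b (eps / 2)) => /=.
    by split; apply: nbhsx_ballx; rewrite divr_gt0.
  move=> [a' b'] /= []; rewrite !ballEmdist /= => aa' bb'.
  by rewrite (le_lt_trans (mdist_NX_add_le _ _ _ _))// [eps]splitr ltrD.
Qed.
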